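(* Let $D=(V,E)$ be a weakly connected finite directed graph and let $e\in E$ be any edge. Then the polynomial $h^*_{D-e}$ is coefficientwise smaller than or equal to $h^*_{D}$, where $D-e$ denotes the digraph obtained by deleting the edge $e$.
   Context: Directed graphs may have loops and multiple edges. For an edge $e$ with tail $t$ and head $h$, let $\mathbf{x}_e\in\mathbb{R}^V$ be the vector with coordinate $1$ at $h$, coordinate $-1$ at $t$, and $0$ elsewhere (so $\mathbf{x}_e=\mathbf{0}$ for a loop). The extended root polytope of $D$ is $\tilde{\mathcal{Q}}_D=\operatorname{conv}(\{\mathbf{0}\}\cup\{\mathbf{x}_e\mid e\in E\})\subset\mathbb{R}^V$, a lattice polytope with respect to $\mathbb{Z}^V$. For a $d$-dimensional lattice polytope $Q\subset\mathbb{R}^n$, its $h^*$-polynomial $\sum_{i=0}^d h^*_i t^i$ is defined by $\sum_{i=0}^d h^*_i t^i=(1-t)^{d+1}\sum_{k\ge 0}|(kQ)\cap\mathbb{Z}^n|\,t^k$. We write $h^*_D$ for the $h^*$-polynomial of $\tilde{\mathcal{Q}}_D$. A digraph is weakly connected if its underlying undirected graph is connected. *)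

(* Defs.v *)
From HB Require Import structures.
From mathcomp Require Import all_boot all_order all_algebra finmap.
From mathcomp Require Import interval_inference.
From mathcomp Require Import boolp classical_sets cardinality reals convex.

Set Implicit Arguments.
Unset Strict Implicit.
Unset Printing Implicit Defensive.

Import Order.TTheory GRing.Theory Num.Theory.

Local Open Scope classical_set_scope.
Local Open Scope ring_scope.

(* Edges form a type of their own, so loops and parallel edges are allowed. *)
Record digraph := Digraph {
  vertex : finType;
  edge : finType;
  tail : edge -> vertex;
  head : edge -> vertex }.

Definition adjacent (D : digraph) : rel (vertex D) :=
  fun u v => [exists f : edge D, ((tail f == u) && (head f == v))
                              || ((tail f == v) && (head f == u))].

Definition weakly_connected (D : digraph) : Prop :=
  forall u v : vertex D, connect (@adjacent D) u v.

Definition delete_edge (D : digraph) (e : edge D) : digraph :=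
  @Digraph (vertex D) {f : edge D | f != e}
    (fun f => tail (val f)) (fun f => head (val f)).

Definition conv_hull (R : realType) (V : lmodType R) (A : set V) : set V :=
  smallest (@convex_set R V) A.

(* Dimension of the affine hull, as one less than the largest number of
   affinely independent points x0, x0 + t_1, ..., x0 + t_k of Q. *)
Definition polytope_dim (R : realType) (V : vectType R) (Q : set V) : nat :=
  \max_(k < (\dim {:V}).+1 |
        `[< exists (x0 : V) (t : k.-tuple V),
              [/\ Q x0, forall i, Q (x0 + tnth t i) & free t] >]) k.

Definition dilate (R : realType) (V : lmodType R) (k : nat) (Q : set V) :
  set V := [set k%:R *: x | x in Q].

Definition lattice (R : realType) (V : finType) : set {ffun V -> R^o} :=
  [set x | forall v, (x v : R) \is a Num.int].

(* [fset_set] returns the empty set on infinite sets; see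
   [finite_lattice_points] below. *)
Definition ehrhart (R : realType) (V : finType) (Q : set {ffun V -> R^o})
    (k : nat) : nat :=
  #|` fset_set (dilate k Q `&` @lattice R V) |.

(* Coefficient of t^i in (1 - t)^(d+1) * \sum_(k >= 0) |kQ \cap Z^V| t^k. *)
Definition hstar_coef (R : realType) (V : finType) (Q : set {ffun V -> R^o})
    (i : nat) : int :=
  \sum_(j < i.+1)
     ((1 - 'X : {poly int}) ^+ (polytope_dim Q).+1)`_j * (ehrhart Q (i - j))%:Z.

(* For a lattice polytope the coefficients of index > d of the series vanish, so
   that this polynomial is the whole series. *)
Definition hstar (R : realType) (V : finType) (Q : set {ffun V -> R^o}) :
    {poly int} :=
  \poly_(i < (polytope_dim Q).+1) hstar_coef Q i.

Lemma hstar_unique (R : realType) (V : finType) (Q : set {ffun V -> R^o})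
    (p : {poly int}) :
  (size p <= (polytope_dim Q).+1)%N -> (forall i, p`_i = hstar_coef Q i) ->
  p = hstar Q.
Proof.
move=> sp pE; apply/polyP => i; rewrite coef_poly -pE.
by case: ltnP => // di; rewrite nth_default// (leq_trans sp).
Qed.

(* The two indicators cancel for a loop. *)
Definition edge_vector (R : realType) (D : digraph) (f : edge D) :
    {ffun vertex D -> R^o} :=
  [ffun v => (v == head f)%:R - (v == tail f)%:R].

Definition extended_root_polytope (R : realType) (D : digraph) :
    set {ffun vertex D -> R^o} :=
  conv_hull ([set 0] `|` range (@edge_vector R D)).

Definition hstar_digraph (R : realType) (D : digraph) : {poly int} :=
  hstar (@extended_root_polytope R D).

Lemma finite_lattice_points (R : realType) (D : digraph) (k : nat) :
  finite_set (dilate k (@extended_root_polytope R D) `&`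
              @lattice R (vertex D)).
Proof.
have Qbound (x : {ffun vertex D -> R^o}) :
    extended_root_polytope x -> forall v, `|x v : R| <= 1.
  pose C := [set y : {ffun vertex D -> R^o} | forall v, `|y v : R| <= 1].
  suff CQ : convex_set C /\
      ([set 0] `|` range (@edge_vector R D)) `<=` C by move=> /(_ C CQ).
  split; last first.
    move=> y [->|[f _ <-]] v; rewrite !ffunE ?normr0//.
    by case: (_ == _); case: (_ == _);
      rewrite ?subrr ?subr0 ?sub0r ?normrN ?normr0 ?normr1.
  move=> y z p; rewrite !inE /= => hy hz v; rewrite !ffunE /=.
  rewrite (le_trans (ler_normD _ _))// !normrM.
  have p0 : 0 <= p%:num by [].
  have p1 : p%:num <= 1 by [].
  have q0 : 0 <= 1 - p%:num by rewrite subr_ge0.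
  rewrite (ger0_norm p0) (ger0_norm q0).
  rewrite [leRHS](_ : 1 = p%:num * 1 + (1 - p%:num) * 1); last first.
    by rewrite !mulr1 addrC subrK.
  by apply: lerD; apply: ler_wpM2l.
pose g (a : {ffun vertex D -> 'I_(k + k).+1}) : {ffun vertex D -> R^o} :=
  [ffun v => (a v)%:R - k%:R].
apply: (@sub_finite_set _ _ (range g)); last exact/finite_image/finite_finset.
move=> _ [[x Qx <-] lx].
have hx v : exists n : 'I_(k + k).+1, (n%:R - k%:R : R) == (k%:R *: x) v.
  have : `|(k%:R *: x) v : R| <= k%:R.
    by rewrite ffunE normrM normr_nat ler_piMr// Qbound.
  rewrite ler_norml => /andP[lb ub].
  have /natrP[n nE] : ((k%:R *: x) v + k%:R : R) \is a Num.nat.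
    rewrite natrEint rpredD ?lx ?rpred_nat//=.
    by rewrite -lerBlDr sub0r.
  have nk : (n < (k + k).+1)%N.
    by rewrite ltnS -(ler_nat R) -nE natrD lerD2r.
  by exists (Ordinal nk); rewrite /= -nE addrK.
exists [ffun v => xchoose (hx v)] => //.
by apply/ffunP => v; rewrite !ffunE (eqP (xchooseP (hx v))) ffunE.
Qed.

(* Main.v *)
(** Homogenize: the lattice points of [k Q] are the lattice points of degree [k]
    in the cone [C] spanned by the vectors [(v, 1)], with [v] either [0] or an
    edge vector.  Let [C'] be the cone of [D - e].

    If [e] is not a bridge, [C] and [C'] span the same space.  Choose generic
    costs on the generators, the cost of [e] being dominant, and a generic point
    [q] in the interior of [C'].  The bases that are optimal for the resulting
    linear programs triangulate [C], those avoiding [e] triangulate [C'], and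
    shifting points infinitesimally towards [q] turns both triangulations into
    partitions by half-open simplicial cones.  So [C \ C'] is a disjoint union of
    half-open simplicial cones of full dimension [d + 1] with generators of
    degree 1, and the counting series of such a cone times [(1 - t)^(d + 1)]
    counts the lattice points that leave the cone when any one generator is
    subtracted, so it has nonnegative coefficients.

    If [e] is a bridge, summing coordinates over one side of it reads off the
    (integral) coefficient of [e], so the polytope of [D] is a pyramid of height
    1 over that of [D - e] and both h*-polynomials agree. *)

From mathcomp Require Import all_boot all_order all_algebra finmap.
From mathcomp Require Import interval_inference.
From mathcomp Require Import boolp classical_sets cardinality reals convex.
From mathcomp Require Import ring lra.
From mathcomp Require polyrcf.
Require Import Defs.

Set Implicit Arguments.
Unset Strict Implicit.
Unset Printing Implicit Defensive.

Import Order.TTheory GRing.Theory Num.Theory.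

Local Open Scope ring_scope.

(** * Coordinates with respect to bases chosen in a finite family *)

Section Coordinates.
Variables (R : realFieldType) (U : lmodType R) (I : finType) (y : I -> U).
Implicit Types (T J : {set I}) (w z : U) (a c : I -> R).

(** [T] indexes a basis of the span of the family, witnessed by its dual functionals extended
    linearly to all of [U]; their values off the span are arbitrary. *)
Definition coordinates T (f : U -> I -> R) : Prop :=
  [/\ forall i k u v, f (k *: u + v) i = k * f u i + f v i,
      forall u i, i \notin T -> f u i = 0,
      forall i j, j \in T -> f (y j) i = (i == j)%:R
    & forall j, y j = \sum_i f (y j) i *: y i].

Definition isbasis T : bool := `[< exists f, coordinates T f >].

Definition co T : U -> I -> R :=
  if pselect (exists f, coordinates T f) is left h then projT1 (cid h)
  else fun _ _ => 0.

Lemma coP T : isbasis T -> coordinates T (co T).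
Proof.
move=> /asboolP bT; rewrite /co; case: pselect => // h.
by case: (cid h).
Qed.

Section Basis.
Variables (T : {set I}) (bT : isbasis T).

Lemma coDZ k u v i : co T (k *: u + v) i = k * co T u i + co T v i.
Proof. by case: (coP bT). Qed.

Lemma co_out u i : i \notin T -> co T u i = 0.
Proof. by case: (coP bT) => _ + _ _; apply. Qed.

Lemma co_gen i j : j \in T -> co T (y j) i = (i == j)%:R.
Proof. by case: (coP bT) => _ _ + _; apply. Qed.

Lemma co_genE j : y j = \sum_i co T (y j) i *: y i.
Proof. by case: (coP bT). Qed.

Lemma co0 i : co T 0 i = 0.
Proof.
have := coDZ 1 0 0 i; rewrite scaler0 addr0 mul1r => /eqP.
by rewrite -subr_eq subrr eq_sym => /eqP.
Qed.

Lemma coZ k u i : co T (k *: u) i = k * co T u i.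
Proof. by have := coDZ k u 0 i; rewrite !addr0 co0 addr0. Qed.

Lemma coD u v i : co T (u + v) i = co T u i + co T v i.
Proof. by rewrite -[u]scale1r coDZ coZ !mul1r. Qed.

Lemma coB u v i : co T (u - v) i = co T u i - co T v i.
Proof. by rewrite coD -scaleN1r coZ mulN1r. Qed.

Lemma co_comb (K : finType) (P : pred K) (a : K -> R) (x : K -> U) i :
  co T (\sum_(j | P j) a j *: x j) i = \sum_(j | P j) a j * co T (x j) i.
Proof.
apply: (big_ind2 (fun u r => co T u i = r)) => [|u r v s <- <-|j _].
- exact: co0.
- exact: coD.
- exact: coZ.
Qed.

Lemma co_uniq w a : w = \sum_i a i *: y i ->
  (forall i, i \notin T -> a i = 0) -> co T w =1 a.
Proof.
move=> -> a0 i; rewrite co_comb (bigID (mem T)) /= [X in _ + X]big1; last first.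
  by move=> j /a0 ->; rewrite mul0r.
rewrite addr0; case: (boolP (i \in T)) => iT; last first.
  by rewrite a0 // big1 // => j jT; rewrite co_out // mulr0.
rewrite (bigD1 i) //= co_gen // eqxx mulr1 big1 ?addr0 // => j /andP[jT ji].
by rewrite co_gen // eq_sym (negbTE ji) mulr0.
Qed.

Lemma co_expand w a : w = \sum_i a i *: y i -> w = \sum_i co T w i *: y i.
Proof.
move=> ->; under [in RHS]eq_bigr => i _ do rewrite co_comb scaler_suml.
rewrite exchange_big /=; apply: eq_bigr => j _.
rewrite {1}[y j]co_genE scaler_sumr; apply: eq_bigr => i _.
by rewrite scalerA.
Qed.

Lemma isbasis_exchange i k : i \notin T -> k \in T -> co T (y i) k != 0 ->
  isbasis (i |: T :\ k).
Proof.
move=> iT kT bk0; set b := co T (y i).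
have ik : i != k by apply: contraNneq iT => ->.
(* The pivot: the [k]-coordinate of [u] divided by [b k] becomes the [i]-coordinate ([b i] is 0),
   and that multiple of [b] is subtracted, which cancels the coordinate at [k]. *)
pose f u j : R := co T u j + (co T u k / b k) * ((j == i)%:R - b j).
have bi : b i = 0 by apply: co_out.
have fgen j : j \in i |: T :\ k -> forall l, f (y j) l = (l == j)%:R.
  rewrite !inE => /orP[/eqP -> l|/andP[jk jT] l].
    by rewrite /f -/b divff // mul1r addrC subrK.
  by rewrite /f (co_gen _ jT) (co_gen _ jT) [k == j]eq_sym (negbTE jk) mul0r mul0r addr0.
apply/asboolP; exists f; split.
- by move=> j s u v; rewrite /f !coDZ; ring.
- move=> u j; rewrite !inE negb_or negb_and negbK => /andP[ji].
  rewrite /f (negbTE ji) => /orP[/eqP ->|jT].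
    by rewrite sub0r mulrN divfK // subrr.
  by rewrite /b (co_out u jT) (co_out (y i) jT) subr0 mulr0 addr0.
- by move=> l j /fgen.
- move=> j; rewrite /f; under eq_bigr => l _ do rewrite scalerDl -scalerA.
  rewrite big_split /= -co_genE -scaler_sumr.
  under [X in _ + _ *: X]eq_bigr => l _ do rewrite scalerBl.
  rewrite sumrB /b -co_genE (bigD1 i) //= eqxx scale1r big1 ?addr0.
    by rewrite subrr scaler0 addr0.
  by move=> l /negbTE ->; rewrite scale0r.
Qed.

End Basis.

Lemma exchange_comb T i w r : isbasis T -> w = \sum_j r j *: y j ->
  forall s, w = \sum_j (r j - s * co T (y i) j + s * (j == i)%:R) *: y j.
Proof.
move=> bT wE s; under eq_bigr => j _ do rewrite scalerDl scalerBl -!scalerA.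
rewrite big_split sumrB /= -wE -!scaler_sumr -(co_genE bT).
rewrite [X in _ + _ *: X](bigD1 i) //= eqxx scale1r big1 ?addr0 ?subrK //.
by move=> l /negbTE ->; rewrite scale0r.
Qed.

(** The minimal ratio [a k / b k] over [0 < b k] is the longest step along [- b] that keeps [a]
    nonnegative on [T]. *)
Lemma ratio_test T (a b : I -> R) l : l \in T -> 0 < b l ->
  (forall j, j \in T -> 0 <= a j) ->
  exists k, [/\ k \in T, 0 < b k, a k / b k <= a l / b l
    & forall j, j \in T -> 0 <= a j - a k / b k * b j].
Proof.
move=> lT bl a0; pose P j := (j \in T) && (0 < b j).
have Pl : P l by rewrite /P lT.
case: (arg_minP (fun j => a j / b j) Pl) => k /andP[kT bk] kmin.
exists k; split => //; first exact: kmin.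
move=> j jT; rewrite subr_ge0; case: (ltP 0 (b j)) => bj.
  by rewrite -ler_pdivlMr //; apply: kmin; rewrite /P jT.
apply: le_trans (a0 _ jT); apply: mulr_ge0_le0 => //.
by rewrite divr_ge0 ?a0 // ltW.
Qed.

Definition cone J w := exists r : I -> R,
  [/\ w = \sum_i r i *: y i, forall i, 0 <= r i & forall i, i \notin J -> r i = 0].

(** Carathéodory's argument, by induction on the number of nonzero coefficients outside the current
    basis: such a generator is either rewritten in the basis or pivoted into it. *)
Lemma cone_basis T0 J w : isbasis T0 -> T0 \subset J -> cone J w ->
  exists T, [/\ isbasis T, T \subset J & forall i, 0 <= co T w i].
Proof.
move=> bT0 T0J [r [wE r0 rJ]].
have [n] := ubnP #|[set i | (i \notin T0) && (r i != 0)]|.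
elim: n => // n IH in T0 bT0 T0J r wE r0 rJ *; set N := [set i | _] => cN.
have [N0|[i iN]] := set_0Vmem N.
  exists T0; split => // i.
  rewrite (co_uniq bT0 wE) // => j jT; apply/eqP/negPn/negP => rj.
  by have := finset.in_set0 j; rewrite -N0 inE jT rj.
move: (iN); rewrite inE => /andP[iT ri].
have iJ : i \in J by apply: contraR ri => /rJ ->.
pose b := co T0 (y i).
have bi : b i = 0 by apply: co_out.
have ri0 : 0 < r i by rewrite lt_neqAle eq_sym ri r0.
have shrink s : s = r i ->
    [set j | (j \notin T0) && (r j + s * b j - s * (j == i)%:R != 0)] \subset N :\ i.
  move=> ->; apply/fintype.subsetP => j; rewrite !inE => /andP[jT].
  have -> : b j = 0 by apply: co_out.
  rewrite mulr0 addr0 jT; case: (eqVneq j i) => [->|_]; first by rewrite mulr1 subrr eqxx.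
  by rewrite mulr0 subr0.
have newE s : w = \sum_j (r j + s * b j - s * (j == i)%:R) *: y j.
  rewrite {1}(exchange_comb i bT0 wE (- s)); apply: eq_bigr => j _.
  by rewrite !mulNr opprK.
have cNi : (#|N :\ i| < n)%N by move: cN; rewrite (cardsD1 i N) iN ltnS.
(* Rewriting [r i *: y i] in the basis adds [r i * b j] to each coefficient; this suffices if none
   becomes negative. *)
have [allpos|] := pselect (forall j, j \in T0 -> 0 <= r j + r i * b j).
  apply: (IH T0 bT0 T0J (fun j => r j + r i * b j - r i * (j == i)%:R)).
  - exact: newE.
  - move=> j; case: (boolP (j \in T0)) => jT.
      have -> : (j == i) = false by apply: contraNF iT => /eqP <-.
      by rewrite mulr0 subr0 allpos.
    have -> : b j = 0 by apply: co_out.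
    rewrite mulr0 addr0.
    by case: (eqVneq j i) => [->|]; rewrite ?mulr1 ?subrr ?mulr0 ?subr0.
  - move=> j jJ; rewrite rJ // (_ : b j = 0) ?mulr0; last first.
      by apply: co_out => //; apply: contra jJ; apply/fintype.subsetP.
    by case: (eqVneq j i) jJ => [->|_]; rewrite ?iJ // mulr0 addr0 subr0.
  - exact: leq_ltn_trans (subset_leq_card (shrink _ erefl)) _.
move=> /existsNP[l /not_implyP[lT /negP]]; rewrite -ltNge => rl.
have bl : 0 < - b l.
  rewrite oppr_gt0 ltNge; apply: contraTN rl => bl; rewrite -leNgt.
  by rewrite addr_ge0 // mulr_ge0 // ltW.
(* Otherwise only a part [s < r i] of the coefficient is moved, up to the first basis coefficient
   that vanishes; its index [k] leaves and [i] enters. *)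
have [k [kT bk kl kpos]] :=
  ratio_test (a := r) (b := fun j => - b j) lT bl (fun j _ => r0 j).
set s := r k / - b k in kl kpos.
have sri : s < r i.
  by apply: le_lt_trans kl _; rewrite ltr_pdivrMr //; lra.
have s0 : 0 <= s by rewrite divr_ge0 // ltW.
have ki : k != i by apply: contraTneq kT => ->.
have T1J : i |: T0 :\ k \subset J.
  apply/fintype.subsetP => j; rewrite !inE => /orP[/eqP-> //|/andP[_]].
  exact/fintype.subsetP.
have bk0 : b k != 0 by rewrite -oppr_eq0 gt_eqF.
apply: (IH _ (isbasis_exchange bT0 iT kT bk0) T1J
  (fun j => r j + s * b j - s * (j == i)%:R)).
- exact: newE.
- move=> j; case: (boolP (j \in T0)) => jT.
    have -> : (j == i) = false by apply: contraNF iT => /eqP <-.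
    by have := kpos j jT; rewrite mulrN opprK mulr0 subr0.
  have -> : b j = 0 by apply: co_out.
  rewrite mulr0 addr0; case: (eqVneq j i) => [->|_]; last by rewrite mulr0 subr0.
  by rewrite mulr1 subr_ge0 ltW.
- move=> j jJ; rewrite rJ // (_ : b j = 0) ?mulr0; last first.
    by apply: co_out => //; apply: contra jJ; apply/fintype.subsetP.
  by case: (eqVneq j i) jJ => [->|_]; rewrite ?iJ // mulr0 addr0 subr0.
- apply: leq_ltn_trans cNi; apply: subset_leq_card.
  apply/fintype.subsetP => j; rewrite !inE !negb_or negb_and negbK -andbA => /and3P[ji].
  rewrite (negbTE ji) mulr0 subr0 => /orP[/eqP ->|jT].
    have -> : r k + s * b k = 0 by rewrite /s; field.
    by rewrite eqxx.
  have -> : b j = 0 by apply: co_out.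
  by rewrite mulr0 addr0 jT.
Qed.

(** * Linear programming over bases: reduced costs and optimality *)

Section Cost.
Variable c : I -> R.

(** For a basis [T] this is the dual solution: the linear functional with value [c i] at [y i] for
    [i] in [T]. *)
Definition cost T w := \sum_i co T w i * c i.

Definition dual_feasible J T := forall i, i \in J -> cost T (y i) <= c i.

Lemma cost_gen T i : isbasis T -> i \in T -> cost T (y i) = c i.
Proof.
move=> bT iT; rewrite /cost (bigD1 i) //= co_gen // eqxx mul1r big1 ?addr0 //.
by move=> j /negbTE ji; rewrite co_gen // ji mul0r.
Qed.

(* The optimal basis of the linear program
   [min \sum_i a i * c i] subject to [w = \sum_i a i *: y i], [a >= 0];
   its reduced costs are nonnegative since otherwise a pivot lowers the cost. *)
Lemma optimal_basis T0 J w : (forall i, 0 < c i) -> isbasis T0 -> T0 \subset J ->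
  cone J w ->
  (forall T k, isbasis T -> k \in T -> co T w k != 0) ->
  exists T, [/\ isbasis T, T \subset J, dual_feasible J T
    & forall i, i \in T -> 0 < co T w i].
Proof.
move=> c0 bT0 T0J Cw gen.
have [T1 [bT1 T1J T1w]] := cone_basis bT0 T0J Cw.
pose P T := [&& isbasis T, T \subset J & [forall i, 0 <= co T w i]].
have PT1 : P T1 by rewrite /P bT1 T1J; apply/forallP.
case: (arg_minP (fun T => cost T w) PT1) => T /and3P[bT TJ /forallP Tw] Tmin.
have Tpos i : i \in T -> 0 < co T w i by move=> iT; rewrite lt_neqAle eq_sym gen // Tw.
exists T; split => // i iJ; rewrite leNgt; apply/negP => red.
have iT : i \notin T by apply: contraTN red => iT; rewrite cost_gen // ltxx.
pose b := co T (y i).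
(* If no coordinate of [y i] were positive, its cost would be at most 0, hence below [c i],
   contradicting [red]. *)
have [l lT bl] : exists2 l, l \in T & 0 < b l.
  apply: contrapT => nl; suff : cost T (y i) <= 0 by rewrite leNgt (lt_trans (c0 i)).
  apply: sumr_le0 => l _; apply: mulr_le0_ge0; last exact: ltW.
  case: (boolP (l \in T)) => lT; last by rewrite co_out.
  by rewrite leNgt; apply/negP => bl; apply: nl; exists l.
have [k [kT bk _ kpos]] := ratio_test (a := co T w) (b := b) lT bl (fun j _ => Tw j).
set s := co T w k / b k in kpos.
have s0 : 0 < s by rewrite divr_gt0 // Tpos.
have bT' := isbasis_exchange bT iT kT (lt0r_neq0 bk).
have bi : b i = 0 by apply: co_out.
have wE : w = \sum_j co T w j *: y j.
  by case: Cw => r [wE _ _]; apply: (co_expand bT wE).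
have coE : co (i |: T :\ k) w =1 (fun j => co T w j - s * b j + s * (j == i)%:R).
  apply: (co_uniq bT') => [|j].
    exact: (exchange_comb i bT wE s).
  rewrite !inE negb_or negb_and negbK => /andP[/negbTE ->] /orP[/eqP ->|jT].
    by rewrite /s divfK ?subrr ?add0r ?mulr0 // lt0r_neq0.
  by rewrite /b !co_out // !mulr0 subr0 addr0.
have PT' : P (i |: T :\ k).
  rewrite /P bT' /=; apply/andP; split.
    apply/fintype.subsetP => j; rewrite !inE => /orP[/eqP-> //|/andP[_]].
    exact/fintype.subsetP.
  apply/forallP => j; rewrite coE; apply: addr_ge0; last by rewrite mulr_ge0 // ltW.
  case: (boolP (j \in T)) => [/kpos //|jT].
  by rewrite /b !co_out // mulr0 subr0.
(* The pivot changes the cost by [s * (c i - cost T (y i))], which is negative. *)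
have := Tmin _ PT'; rewrite leNgt => /negP; apply.
rewrite /cost (eq_bigr (fun j => co T w j * c j - s * (b j * c j)
    + s * ((j == i)%:R * c j))); last by move=> j _; rewrite coE; ring.
rewrite big_split sumrB /= -!mulr_sumr [X in _ + s * X](bigD1 i) //= eqxx mul1r.
rewrite [X in c i + X]big1 => [|j /negbTE ->]; last by rewrite mul0r.
rewrite addr0 -/(cost T (y i)); move: red; rewrite -subr_gt0 => /(mulr_gt0 s0).
by rewrite mulrBr; lra.
Qed.

Lemma costE T w a : isbasis T -> w = \sum_i a i *: y i ->
  cost T w = \sum_i a i * cost T (y i).
Proof.
move=> bT ->; rewrite /cost.
under eq_bigr => i _ do rewrite co_comb // mulr_suml.
rewrite exchange_big /=; apply: eq_bigr => j _.
by rewrite mulr_sumr; apply: eq_bigr => i _; rewrite mulrA.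
Qed.

(** Weak duality gives [cost T' w <= cost T w]. An [i] in [T'] outside [T] would have a positive
    coordinate and, by genericity, a positive reduced cost, forcing [cost T w < cost T' w]. *)
Lemma optimal_basis_sub T T' w a :
  (forall T i, isbasis T -> i \notin T -> cost T (y i) != c i) ->
  isbasis T -> isbasis T' -> dual_feasible [set: I] T -> dual_feasible [set: I] T' ->
  w = \sum_i a i *: y i ->
  (forall i, i \in T -> 0 < co T w i) -> (forall i, i \in T' -> 0 < co T' w i) ->
  T' \subset T.
Proof.
have le S S' : isbasis S -> isbasis S' -> dual_feasible [set: I] S ->
    w = \sum_i a i *: y i -> (forall i, i \in S' -> 0 < co S' w i) ->
    cost S w <= cost S' w.
  move=> bS bS' dS wE pS'; rewrite (costE bS (co_expand bS' wE)).
  apply: ler_sum => i _; case: (boolP (i \in S')) => iS'.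
    by rewrite ler_wpM2l ?dS ?inE // ltW // pS'.
  by rewrite co_out // !mul0r.
move=> gen bT bT' dT dT' wE pT pT'; apply/fintype.subsetP => i iT'.
apply: contraT => iT; have := gen _ _ bT iT; rewrite neq_lt => nc.
have := le _ _ bT' bT dT' wE pT; rewrite leNgt => /negP[].
rewrite (costE bT (co_expand bT' wE)) {2}/cost (bigD1 i) //= [ltRHS](bigD1 i) //=.
apply: ltr_leD.
  by rewrite ltr_pM2l ?pT' // lt_neqAle dT ?inE // andbT neq_lt.
apply: ler_sum => j _; case: (boolP (j \in T')) => jT'.
  by rewrite ler_wpM2l ?dT ?inE // ltW // pT'.
by rewrite co_out // !mul0r.
Qed.

End Cost.
End Coordinates.

(** * Existence of bases inside a spanning subfamily, and their cardinality *)

Section BasisExistence.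
Variables (R : realFieldType) (U : vectType R) (I : finType) (y : I -> U).
Implicit Types T J : {set I}.

Lemma exists_dual_functional (v : U) : v != 0 ->
  exists f : U -> R, (forall k u w, f (k *: u + w) = k * f u + f w) /\ f v = 1.
Proof.
move=> v0; exists (coord [tuple v] ord0); split.
  by move=> k u w; rewrite linearP.
have fv : free [tuple v] by rewrite seq1_free.
by rewrite (coord_free ord0 ord0 fv).
Qed.

(** Indices of [J] are added one at a time, keeping a [T] that is a basis for those seen so far; the
    hypothesis says that [J] spans the whole family. *)
Lemma exists_isbasis J : (forall i, exists2 a : I -> R,
    y i = \sum_j a j *: y j & forall j, j \notin J -> a j = 0) ->
  exists2 T, isbasis y T & T \subset J.
Proof.
move=> yJ; pose partial (K : {set I}) T (f : U -> I -> R) :=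
  [/\ forall i k u v, f (k *: u + v) i = k * f u i + f v i,
      forall u i, i \notin T -> f u i = 0,
      forall i j, j \in T -> f (y j) i = (i == j)%:R
    & forall j, j \in K -> y j = \sum_i f (y j) i *: y i].
suff H (K : {set I}) : exists2 T, (exists f, partial K T f) & T \subset K.
  have [T [f [flin fout fgen fJ]] TJ] := H J; exists T => //.
  apply/asboolP; exists f; split => // i; have [a yE a0] := yJ i.
  have f0 j : f 0 j = 0.
    have := flin j 1 0 0; rewrite scaler0 addr0 mul1r => /eqP.
    by rewrite -subr_eq subrr eq_sym => /eqP.
  have fsum j : f (y i) j = \sum_k a k * f (y k) j.
    rewrite yE; apply: (big_rec2 (fun u r => f u j = r)) => // k r u _ <-.
    by rewrite flin.
  under eq_bigr => j _ do rewrite fsum scaler_suml.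
  rewrite exchange_big /= {1}yE; apply: eq_bigr => k _.
  case: (boolP (k \in J)) => [kJ|/a0 ->].
    rewrite {1}(fJ _ kJ) scaler_sumr; apply: eq_bigr => j _.
    by rewrite scalerA.
  by rewrite scale0r big1 // => j _; rewrite mul0r scale0r.
have [n] := ubnP #|K|; elim: n K => // n IH K cK.
have [->|[j jK]] := set_0Vmem K.
  exists finset.set0; last exact: finset.sub0set.
  exists (fun _ _ => 0); split => [i k u v|//|i j|j]; rewrite ?inE //.
  by rewrite mulr0 addr0.
have [|T [f [flin fout fgen fK]] TK] := IH (K :\ j).
  by move: cK; rewrite (cardsD1 j) jK ltnS.
have KE i : i \in K -> i != j -> i \in K :\ j by rewrite !inE => -> ->.
have jT : j \notin T by apply/negP => /(fintype.subsetP TK); rewrite !inE eqxx.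
(* The residual of [u] modulo the current [T]. If it vanishes at [y j], [T] is kept; otherwise a
   functional [h] equal to 1 on it yields the new [j]-coordinate. *)
pose v u := u - \sum_i f u i *: y i.
have [vj0|vj] := eqVneq (v (y j)) 0.
  exists T; last exact: fintype.subset_trans TK (finset.subD1set _ _).
  exists f; split => // i iK; have [->|ij] := eqVneq i j; last exact/fK/KE.
  by apply/eqP; rewrite -subr_eq0 -/(v (y j)) vj0.
have [h [hlin h1]] := exists_dual_functional vj.
have h0 : h 0 = 0.
  have := hlin 1 0 0; rewrite scaler0 addr0 mul1r => /eqP.
  by rewrite -subr_eq subrr eq_sym => /eqP.
have vlin k u w : v (k *: u + w) = k *: v u + v w.
  rewrite /v (eq_bigr (fun i => k *: (f u i *: y i) + f w i *: y i)).
    rewrite big_split /= -scaler_sumr scalerBr; apply/eqP; rewrite -subr_eq0; apply/eqP.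
    by rewrite opprD [k *: u + w + _]addrACA subrr.
  by move=> i _; rewrite flin scalerDl scalerA.
pose g u i : R := f u i + h (v u) * ((i == j)%:R - f (y j) i).
have vT i : i \in T -> v (y i) = 0.
  move=> iT; rewrite /v -fK ?subrr //; exact: (fintype.subsetP TK).
exists (j |: T); last first.
  apply/fintype.subsetP => i; rewrite !inE => /orP[/eqP-> //|/(fintype.subsetP TK)].
  by rewrite !inE => /andP[].
exists g; split.
- by move=> i k u w; rewrite /g vlin hlin flin; ring.
- move=> u i; rewrite !inE negb_or => /andP[/negbTE ij iT].
  by rewrite /g ij !fout // subr0 mulr0 addr0.
- move=> i k; rewrite !inE => /orP[/eqP ->|kT].
    by rewrite /g h1 mul1r addrC subrK.
  by rewrite /g vT // h0 mul0r addr0 fgen.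
- move=> k kK; rewrite /g.
  under eq_bigr => i _ do rewrite scalerDl -scalerA scalerBl.
  rewrite big_split /= -scaler_sumr sumrB (bigD1 (P := predT) j) //=.
  rewrite [X in _ + _ *: (X + _)](bigD1 j) //= eqxx scale1r.
  rewrite [X in _ *: (y j + X + _)]big1 => [|i /negbTE ->]; last by rewrite scale0r.
  rewrite addr0 -/(v (y j)) -(bigD1 (P := predT) (F := fun i => f (y k) i *: y i) j) //=.
  have [->|kj] := eqVneq k j; first by rewrite h1 scale1r /v addrC subrK.
  by rewrite -fK ?KE // /v -fK ?KE // subrr h0 scale0r addr0.
Qed.

Lemma isbasis_basis_of T : isbasis y T ->
  basis_of <<codom y>> [tuple y (enum_val m) | m < #|T|].
Proof.
move=> bT; set X := [tuple _ | _ < _].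
have Xm (m : 'I_#|T|) : X`_m = y (enum_val m).
  by rewrite -[LHS](tnth_nth 0 X m) tnth_mktuple.
apply/andP; split; last first.
  apply/freeP => k sk m; have := co0 bT (enum_val m).
  rewrite -{1}sk co_comb // (bigD1 m) //= Xm co_gen ?enum_valP // eqxx mulr1.
  rewrite big1 ?addr0 // => l lm; rewrite Xm co_gen ?enum_valP //.
  by rewrite (inj_eq enum_val_inj) eq_sym (negbTE lm) mulr0.
rewrite eqEsubv; apply/andP; split; apply/span_subvP => u.
  by move=> /mapP[m _ ->]; apply/memv_span/codom_f.
move=> /codomP[j ->]; rewrite (co_genE bT j); apply: memv_suml => i _.
case: (boolP (i \in T)) => iT; last by rewrite co_out // scale0r mem0v.
apply/memvZ/memv_span/mapP; exists (enum_rank_in iT i); rewrite ?mem_enum //.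
by rewrite enum_rankK_in.
Qed.

Lemma card_isbasis T : isbasis y T -> #|T| = \dim <<codom y>>.
Proof. by move=> /isbasis_basis_of/size_basis. Qed.

End BasisExistence.

(** * Half-open decomposition of a cone *)

Section Generic.
Variable R : realFieldType.

(** A number that behaves as plus infinity for finitely many polynomials; it realizes dominant costs
    and generic points inside [R]. *)
Lemma large_eval (K : finType) (p : K -> {poly R}) :
  exists2 s, 0 < s &
    forall k, p k != 0 -> Num.sg (p k).[s] = Num.sg (lead_coef (p k)).
Proof.
have pos (q : {poly R}) : 0 < lead_coef q ->
    exists n, forall x, n <= x -> 0 < q.[x].
  move=> q0; have [n nP] := polyrcf.poly_pinfty_gt_lc q0.
  by exists n => x /nP; apply: lt_le_trans.
have /choice[b bP] k : exists n, forall x, n <= x -> p k != 0 ->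
    Num.sg (p k).[x] = Num.sg (lead_coef (p k)).
  have [pk0|pk0|/eqP] := ltgtP (lead_coef (p k)) 0.
  - have [|n nP] := pos (- p k); first by rewrite lead_coefN oppr_gt0.
    exists n => x /nP; rewrite hornerN oppr_gt0 => px _.
    by rewrite !ltr0_sg.
  - have [n nP] := pos _ pk0; exists n => x /nP px _.
    by rewrite !gtr0_sg.
  - by rewrite lead_coef_eq0 => /eqP ->; exists 0 => x _; rewrite eqxx.
have S0 : 0 <= \sum_k `|b k| by apply: sumr_ge0.
exists (1 + \sum_k `|b k|); first exact: ltr_wpDr.
move=> k; apply: bP; apply: ler_wpDl => //.
rewrite (bigD1 k) //= -[leLHS]addr0 lerD ?ler_norm //.
exact: sumr_ge0.
Qed.

(** Positivity of [a + eps * b] for an infinitesimal [eps > 0]. *)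
Definition lexpos (a b : R) := (0 < a) || (a == 0) && (0 < b).

Lemma lexpos_scale (K : finType) (a b : K -> R) : exists2 s, 0 < s &
  forall k, b k != 0 ->
    (0 < s * a k + b k) = lexpos (a k) (b k) /\ s * a k + b k != 0.
Proof.
(* This exceeds every ratio of absolute values of [b k] and [a k]; where [a k] is 0 the quotient is
   0 by convention and adds nothing. *)
exists (1 + \sum_k `|b k| / `|a k|) => [|k bk].
  by rewrite ltr_pwDl // sumr_ge0 // => k _; rewrite divr_ge0.
set s := 1 + _; rewrite /lexpos.
have [->|ak] := eqVneq (a k) 0; first by rewrite mulr0 add0r ltxx.
have sab : `|b k| < s * `|a k|.
  rewrite -ltr_pdivrMr ?normr_gt0 // /s (bigD1 k) //= addrCA ltrDl.
  by rewrite ltr_pwDl // sumr_ge0 // => l _; rewrite divr_ge0.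
rewrite orbF; have [ak0|ak0|/eqP] := ltgtP (a k) 0; last by rewrite (negbTE ak).
  move: sab; rewrite (ltr0_norm ak0) mulrN ltr_norml opprK => /andP[_ h].
  have h' : s * a k + b k < 0 by lra.
  by rewrite (lt_eqF h') ltNge (ltW h').
move: sab; rewrite (gtr0_norm ak0) ltr_norml => /andP[h _].
have h' : 0 < s * a k + b k by lra.
by rewrite (gt_eqF h').
Qed.

End Generic.

Section HalfOpen.
Variables (R : realFieldType) (U : lmodType R) (I : finType) (y : I -> U).
Implicit Types (T J : {set I}) (w q : U).

(* The second condition says that [w + t *: q] is interior to the cone of [T]
   for all small [t > 0]. *)
Definition half_open q T w :=
  w = \sum_i co y T w i *: y i /\
  forall i, i \in T -> lexpos (co y T w i) (co y T q i).

Lemma half_open_cone q T w : isbasis y T -> half_open q T w -> cone y T w.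
Proof.
move=> bT [wE lw]; exists (co y T w); split => // [i|i /co_out ->] //.
case: (boolP (i \in T)) => [/lw|/co_out -> //].
by case/orP => [/ltW //|/andP[/eqP ->]].
Qed.

(** [Delta] collects the dual feasible bases: an optimal basis at [t *: w + q] gives covering, its
    uniqueness gives disjointness. A basis optimal without [e] stays dual feasible with [e], whose
    cost dominates. *)
Lemma half_open_partition (e : I) T0 : isbasis y T0 -> e \notin T0 ->
  exists (Delta : {set {set I}}) q,
  [/\ forall T, T \in Delta -> isbasis y T,
      forall w, cone y [set: I] w -> exists2 T, T \in Delta & half_open q T w,
      forall w T T', T \in Delta -> T' \in Delta ->
        half_open q T w -> half_open q T' w -> T = T'
    & forall w, cone y [set~ e] w ->
        exists2 T, T \in Delta & half_open q T w /\ e \notin T].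
Proof.
move=> bT0 eT0; have T0e : T0 \subset [set~ e].
  by apply/fintype.subsetP => i iT; rewrite !inE; apply: contraNneq eT0 => <-.
(* [e] gets the largest exponent, so [s ^+ idx e] dominates the other costs for large [s]. *)
pose idx (i : I) : nat := if i == e then #|I| else enum_rank i.
have idx_lt i : i != e -> (idx i < #|I|)%N by rewrite /idx => /negbTE ->.
have idxe : idx e = #|I| by rewrite /idx eqxx.
have idx_inj : injective idx.
  move=> i j; rewrite /idx; case: eqVneq => [->|_]; case: eqVneq => [-> //|_].
  - by move=> h; have := ltn_ord (enum_rank j); rewrite -h ltnn.
  - by move=> h; have := ltn_ord (enum_rank i); rewrite h ltnn.
  - by move=> /val_inj/enum_rank_inj.
pose P (b : I -> R) : {poly R} := \sum_k b k *: 'X^(idx k).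
have coefP b i : (P b)`_(idx i) = b i.
  rewrite coef_sum (bigD1 i) //= coefZ coefXn eqxx mulr1 big1 ?addr0 // => j ji.
  by rewrite coefZ coefXn (inj_eq idx_inj) eq_sym (negbTE ji) mulr0.
have hornerP b s : (P b).[s] = \sum_k b k * s ^+ idx k.
  by rewrite horner_sum; apply: eq_bigr => k _; rewrite !hornerE.
(* The reduced cost of [k.2] at the basis [k.1], as a polynomial in [s]; for [k.2] outside [k.1] its
   coefficient at [idx k.2] is 1, so it is nonzero. *)
pose pc (k : {set I} * I) : {poly R} := 'X^(idx k.2) - P (co y k.1 (y k.2)).
have [s s0 sP] := large_eval pc.
pose c i := s ^+ idx i.
have costE T i : c i - cost y c T (y i) = (pc (T, i)).[s].
  by rewrite /pc /= hornerD hornerN hornerP hornerXn.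
have c0 i : 0 < c i by rewrite exprn_gt0.
have pc1 T i : isbasis y T -> i \notin T -> (pc (T, i))`_(idx i) = 1.
  by move=> bT iT; rewrite coefB coefXn eqxx coefP /= co_out // subr0.
have cgen T i : isbasis y T -> i \notin T -> cost y c T (y i) != c i.
  move=> bT iT; rewrite eq_sym -subr_eq0 costE -sgr_eq0.
  suff pc0 : pc (T, i) != 0 by rewrite sP // sgr_eq0 lead_coef_eq0.
  apply/eqP => pc0; have := pc1 _ _ bT iT.
  by rewrite pc0 coef0 => /eqP; rewrite eq_sym oner_eq0.
have ce T : isbasis y T -> e \notin T -> cost y c T (y e) <= c e.
  move=> bT eT; have lc : lead_coef (pc (T, e)) = 1.
    rewrite /pc /= lead_coefDl ?lead_coefXn // size_polyN size_polyXn ltnS idxe.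
    apply: leq_trans (size_sum _ _ _) _; apply/bigmax_leqP => k _.
    have [->|ke] := eqVneq k e; first by rewrite co_out // scale0r size_poly0.
    by apply: leq_trans (size_scale_leq _ _) _; rewrite size_polyXn; apply: idx_lt.
  rewrite -subr_ge0 costE -sgr_ge0 sP ?lc ?sgr1 //.
  by rewrite -lead_coef_eq0 lc oner_eq0.
(* The [k.2]-coordinate of [q] in the basis [k.1], as a polynomial in the parameter [u] that defines
   [q]. *)
pose pq (k : {set I} * I) : {poly R} :=
  P (fun i => if i == e then 0 else co y k.1 (y i) k.2).
have [u u0 uP] := large_eval pq.
pose q := \sum_(i | i != e) u ^+ idx i *: y i.
have qE T k : isbasis y T -> co y T q k = (pq (T, k)).[u].
  move=> bT; rewrite co_comb // hornerP [RHS](bigD1 e) //= eqxx mul0r add0r.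
  by apply: eq_bigr => i /negbTE ->; rewrite mulrC.
have qgen T k : isbasis y T -> k \in T -> co y T q k != 0.
  move=> bT kT; rewrite qE // -sgr_eq0.
  suff pq0 : pq (T, k) != 0 by rewrite uP // sgr_eq0 lead_coef_eq0.
  (* The [k]-coordinate cannot vanish on all generators but [e], since [y e] is a combination of
     these via [T0]. *)
  have [i ie ki] : exists2 i, i != e & co y T (y i) k != 0.
    have [ke|ke] := eqVneq k e; last by exists k => //; rewrite co_gen // eqxx oner_eq0.
    apply: contrapT => nex; have := co_gen bT k kT; rewrite eqxx => /eqP.
    rewrite {1}ke (co_genE bT0 e) co_comb // big1 ?(eq_sym 0) ?oner_eq0 // => i _.
    have [->|ie] := eqVneq i e; first by rewrite (co_out bT0) // mul0r.
    have [->|ki] := eqVneq (co y T (y i) k) 0; first by rewrite mulr0.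
    by case: nex; exists i.
  apply/eqP => p0; have := coefP (fun i => if i == e then 0 else co y T (y i) k) i.
  by rewrite -/(pq (T, k)) p0 coef0 (negbTE ie) => /esym/eqP; rewrite (negbTE ki).
have Cq J w t : [set~ e] \subset J -> 0 < t -> cone y J w -> cone y J (t *: w + q).
  move=> eJ t0 [r [-> r0 rJ]].
  exists (fun i => t * r i + (i != e)%:R * u ^+ idx i); split.
  - rewrite scaler_sumr /q [X in _ + X]big_mkcond -big_split /=; apply: eq_bigr => i _.
    by rewrite scalerDl scalerA; case: eqP; rewrite ?mul0r ?mul1r ?scale0r.
  - by move=> i; rewrite addr_ge0 ?mulr_ge0 ?exprn_ge0 // ltW.
  - move=> i iJ; rewrite rJ // mulr0 add0r (_ : i == e) ?mul0r //.
    by apply: contraR iJ => ie; apply: (fintype.subsetP eJ); rewrite !inE.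
pose Delta : {set {set I}} :=
  [set T | isbasis y T && `[< dual_feasible y c [set: I] T >]].
(* A large [t] replaces the infinitesimal: [t *: w + q] is a positive multiple of
   [w + t^-1 *: q]. *)
have lex w : exists2 t, 0 < t & forall T i, isbasis y T -> i \in T ->
    (0 < co y T (t *: w + q) i) = lexpos (co y T w i) (co y T q i) /\
    co y T (t *: w + q) i != 0.
  have [t t0 tP] := lexpos_scale
    (fun k : {set I} * I => co y k.1 w k.2) (fun k => co y k.1 q k.2).
  by exists t => // T i bT iT; rewrite coDZ //; apply: (tP (T, i)); apply: qgen.
have ex J w : [set~ e] \subset J -> cone y J w ->
    exists T, [/\ isbasis y T, T \subset J, dual_feasible y c J T & half_open q T w].
  move=> eJ Cw; have [t t0 tP] := lex w.
  have T0J := fintype.subset_trans T0e eJ.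
  have [|T [bT TJ dT pT]] := optimal_basis c0 bT0 T0J (Cq _ _ _ eJ t0 Cw).
    by move=> T k bT kT; case: (tP T k bT kT).
  exists T; split => //; split => [|i iT].
    by case: Cw => r [wE _ _]; apply: (co_expand bT wE).
  by case: (tP T i bT iT) => <- _; apply: pT.
exists Delta, q; split.
- by move=> T; rewrite inE => /andP[].
- move=> w Cw; have [T [bT _ dT hT]] := ex _ _ (finset.subsetT _) Cw.
  by exists T => //; rewrite inE bT; apply/asboolP.
- move=> w T T'; rewrite !inE => /andP[bT /asboolP dT] /andP[bT' /asboolP dT'].
  move=> [wE hT] [_ hT']; have [t t0 tP] := lex w.
  have pos S : isbasis y S -> (forall i, i \in S -> lexpos (co y S w i) (co y S q i)) ->
      forall i, i \in S -> 0 < co y S (t *: w + q) i.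
    by move=> bS hS i iS; case: (tP S i bS iS) => -> _; apply: hS.
  have [a twE] : exists a : I -> R, t *: w + q = \sum_i a i *: y i.
    exists (fun i => t * co y T w i + (i != e)%:R * u ^+ idx i).
    rewrite {1}wE scaler_sumr /q [X in _ + X]big_mkcond -big_split /=.
    apply: eq_bigr => i _; rewrite scalerDl scalerA.
    by case: eqP; rewrite ?mul0r ?mul1r ?scale0r.
  apply/eqP; rewrite finset.eqEsubset.
  by apply/andP; split; apply: (optimal_basis_sub cgen _ _ _ _ twE); auto.
- move=> w Cw; have [T [bT Te dT hT]] := ex _ _ (fintype.subxx _) Cw.
  have eT : e \notin T by apply/negP => /(fintype.subsetP Te); rewrite !inE eqxx.
  exists T => //; rewrite inE bT; apply/asboolP => i _.
  have [->|ie] := eqVneq i e; first exact: ce.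
  by apply: dT; rewrite !inE.
Qed.

End HalfOpen.

(** * Iterated differences of counting functions *)

Section Difference.

(** Coefficients of [1 - t] times the generating series of [f], with [f] taken as 0 at -1. *)
Definition diff (f : nat -> int) (k : nat) : int :=
  f k - (if k is k'.+1 then f k' else 0).

Lemma coef_1subX_exp n (f : nat -> int) i :
  \sum_(j < i.+1) ((1 - 'X : {poly int}) ^+ n)`_j * f (i - j)%N
  = iter n diff f i.
Proof.
elim: n i => [|n IH] i.
  rewrite expr0 (bigD1 ord0) //= coef1 mul1r subn0 big1 ?addr0 // => j j0.
  by rewrite coef1 (_ : (j == 0 :> nat) = false) ?mul0r //; apply/negbTE.
rewrite iterS /diff -IH exprSr.
under eq_bigr => j _ do rewrite mulrBr mulr1 coefB mulrBl coefMX.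
rewrite sumrB; congr (_ - _); case: i => [|i].
  by rewrite big_ord_recl big_ord0 mul0r.
rewrite -IH big_ord_recl mul0r add0r; apply: eq_bigr => j _.
by rewrite /= subSS.
Qed.

Lemma iter_diff_sum (K : finType) (P : pred K) n (f : K -> nat -> int) :
  iter n diff (fun k => \sum_(i | P i) f i k)
  = (fun k => \sum_(i | P i) iter n diff (f i) k).
Proof.
elim: n => // n IH; apply/funext => k; rewrite iterS IH /diff.
case: k => [|k]; last by rewrite -sumrB.
by rewrite subr0; apply: eq_bigr => i _; rewrite iterS /diff subr0.
Qed.

Lemma iter_diffB n (f g : nat -> int) :
  iter n diff (fun k => f k - g k) = (fun k => iter n diff f k - iter n diff g k).
Proof.
elim: n => // n IH; apply/funext => k; rewrite !iterS IH /diff.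
by case: k => [|k]; ring.
Qed.

Lemma card_fset_partition (K : choiceType) (J : finType) (P : pred J)
    (A : {fset K}) (B : J -> {fset K}) :
  (forall x, x \in A -> exists2 i, P i & x \in B i) ->
  (forall i, P i -> (B i `<=` A)%fset) ->
  (forall i j x, P i -> P j -> x \in B i -> x \in B j -> i = j) ->
  #|` A| = (\sum_(i | P i) #|` B i|)%N.
Proof.
move=> AB BA Bdisj; rewrite -sum1_size.
transitivity (\sum_(x <- A) \sum_(i | P i) (x \in B i : nat))%N.
  apply: eq_big_seq => x xA; have [i Pi xi] := AB x xA.
  rewrite (bigD1 i) //= xi big1 // => j /andP[Pj ji]; apply/eqP.
  by rewrite eqb0; apply: contra ji => xj; apply/eqP; apply: (Bdisj j i x).
rewrite exchange_big; apply: eq_bigr => i Pi.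
transitivity (\sum_(x <- A | x \in B i) 1)%N.
  by rewrite [RHS]big_mkcond; apply: eq_bigr => x _; case: (x \in B i).
rewrite sum1_count -size_filter; apply/perm_size/uniq_perm.
- by rewrite filter_uniq ?fset_uniq.
- exact: fset_uniq.
move=> x; rewrite mem_filter; case: (boolP (x \in B i)) => //= xi.
by have /fsubsetP := BA _ Pi; apply.
Qed.

Definition prev_fset (K : choiceType) (F : nat -> {fset K}) (k : nat) : {fset K} :=
  if k is k'.+1 then F k' else fset0%fset.

(* Each [v i] acts freely on the sets [F k], and independently of the others;
   one difference removes the image of one translation. *)
Lemma iter_diff_card_ge0 (K : zmodType) (J : eqType) (v : J -> K) (s : seq J)
    (F : nat -> {fset K}) : uniq s ->
  (forall k x i, i \in s -> x \in F k -> x + v i \in F k.+1) ->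
  (forall k x i j, i \in s -> j \in s -> i != j ->
     x \in F k -> x + v i - v j \in F k -> x - v j \in prev_fset F k) ->
  forall k, 0 <= iter (size s) diff (fun k => #|` F k|%:Z) k.
Proof.
elim: s F => [|i0 s IH] F //= /andP[i0s us] Fadd Findep k.
pose tr (k : nat) := [fset (x + v i0)%R | x in prev_fset F k]%fset.
have trE l x : (x \in tr l) = (x - v i0 \in prev_fset F l).
  apply/imfsetP/idP => [[z zF ->]|xF]; first by rewrite addrK.
  by exists (x - v i0) => //=; rewrite subrK.
have trF l : (tr l `<=` F l)%fset.
  apply/fsubsetP => x; rewrite trE; case: l => [|l] /=; first by rewrite in_fset0.
  by move=> /(Fadd _ _ i0); rewrite mem_head subrK; apply.
(* What remains of [F l]: the elements that leave the family when [v i0] is subtracted. *)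
pose F' l := (F l `\` tr l)%fset.
have cF' : diff (fun k => #|` F k|%:Z) = (fun k => #|` F' k|%:Z).
  apply/funext => l; rewrite /F' cardfsDS // -subzn ?fsubset_leq_card //.
  congr (_ - _); rewrite /tr card_imfset /=; last exact: addIr.
  by case: l => //=; rewrite cardfs0.
rewrite -iterS iterSr cF'; apply: IH => //.
  move=> l x i si; rewrite !inE !trE => /andP[xn xF].
  have si' : i \in i0 :: s by rewrite inE si orbT.
  rewrite (Fadd _ _ _ si' xF) andbT; apply: contra xn => /= xF'.
  apply: (Findep _ _ i i0 si') xF' => //; first by rewrite mem_head.
  by apply: contraNneq i0s => <-.
move=> l x i j si sj ij; rewrite !inE !trE => /andP[xn xF] /andP[xn' xF'].
have si' : i \in i0 :: s by rewrite inE si orbT.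
have sj' : j \in i0 :: s by rewrite inE sj orbT.
have := Findep _ _ _ _ si' sj' ij xF xF'.
case: l xn xF xn' xF' => [|l] //= xn xF xn' xF' xj; rewrite !inE trE xj andbT.
(* If [x - v j - v i0] were in the family two degrees lower, adding [v j] would put [x - v i0] in it
   one degree lower, against [xn]. *)
apply: contra xn; case: l xF xF' xn' xj => [|l] //= xF xF' xn' xj.
by move=> /(Fadd _ _ j sj'); rewrite addrAC subrK.
Qed.

End Difference.

(** * Adding a generator to a cone over a lattice polytope *)

Section Monotonicity.
Variables (R : realFieldType) (V : vectType R) (I : finType) (v : I -> V).

Definition lifted (i : I) : V * R^o := (v i, 1).

Lemma sum_lifted (r : I -> R) :
  \sum_i r i *: lifted i = (\sum_i r i *: v i, \sum_i r i).
Proof.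
elim/big_rec3: _ => //= i a b c _ ->; congr (_, _ + _).
exact: mulr1.
Qed.

Lemma cone_deg J (x : V) (k : R^o) : cone lifted J (x, k) <->
  exists r : I -> R, [/\ x = \sum_i r i *: v i, k = \sum_i r i,
    forall i, 0 <= r i & forall i, i \notin J -> r i = 0].
Proof.
split=> [[r [+ r0 rJ]]|[r [-> -> r0 rJ]]]; last by exists r; rewrite sum_lifted.
by rewrite sum_lifted => -[-> ->]; exists r.
Qed.

Variables (L : V -> Prop) (e : I) (G G' : nat -> {fset V}).
Hypothesis LD : forall x i, L x -> L (x + v i).
Hypothesis LB : forall x i, L x -> L (x - v i).
Hypothesis GP : forall k x, (x \in G k) <-> L x /\ cone lifted [set: I] (x, k%:R).
Hypothesis GP' : forall k x, (x \in G' k) <-> L x /\ cone lifted [set~ e] (x, k%:R).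

(** The hypothesis on [e] provides a basis avoiding it, hence a half-open partition. The difference
    counts the cones whose basis [T] contains [e]; each is treated by [iter_diff_card_ge0] with the
    translations [v i], [i] in [T], whose number is the dimension. *)
Lemma iter_diff_cone_ge0 (b : I -> R) :
  lifted e = \sum_(i | i != e) b i *: lifted i ->
  forall k, 0 <= iter (\dim <<codom lifted>>) diff
    (fun k => #|` G k|%:Z - #|` G' k|%:Z) k.
Proof.
move=> eE.
have [i|T0 bT0 T0e] := exists_isbasis (y := lifted) (J := [set~ e]).
  have [->|ie] := eqVneq i e.
    exists (fun i => if i == e then 0 else b i) => [|j]; last first.
      by rewrite !inE negbK => ->.
    rewrite {1}eE [RHS](bigD1 e) //= eqxx scale0r add0r.
    by apply: eq_bigr => j /negbTE ->.
  exists (fun j => (j == i)%:R) => [|j]; last first.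
    by rewrite !inE negbK => /eqP ->; rewrite eq_sym (negbTE ie).
  rewrite (bigD1 i) //= eqxx scale1r big1 ?addr0 // => j /negbTE ->.
  by rewrite scale0r.
have eT0 : e \notin T0 by apply/negP => /(fintype.subsetP T0e); rewrite !inE eqxx.
have [Delta [q [Db Dex Duniq Dex']]] := half_open_partition bT0 eT0.
pose F T k := [fset x in G k | `[< half_open lifted q T (x, k%:R) >]]%fset.
have FP T k x : T \in Delta ->
    reflect (L x /\ half_open lifted q T (x, k%:R)) (x \in F T k).
  move=> TD; rewrite !inE; apply: (iffP andP) => [[/GP[Lx _] /asboolP]|[Lx hx]] //.
  split; last exact/asboolP.
  apply/GP; split => //; have [r [-> r0 _]] := half_open_cone (Db _ TD) hx.
  by exists r; split => // i; rewrite inE.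
have cG k : #|` G k| = (\sum_(T in Delta) #|` F T k|)%N.
  apply: card_fset_partition => [x|T _|T T' x TD T'D].
  - move=> /GP[Lx /Dex[T TD hT]]; exists T => //; exact/FP.
  - by apply/fsubsetP => x; rewrite !inE => /andP[].
  - by move=> /FP-/(_ TD)[_ h] /FP-/(_ T'D)[_ h']; apply: (Duniq (x, k%:R)).
have cG' k : #|` G' k| = (\sum_(T in Delta | e \notin T) #|` F T k|)%N.
  apply: card_fset_partition => [x|T|T T' x /andP[TD _] /andP[T'D _]].
  - by move=> /GP'[Lx /Dex'[T TD [hT eT]]]; exists T; [apply/andP|apply/FP].
  - move=> /andP[TD eT]; apply/fsubsetP => x /FP-/(_ TD)[Lx hx]; apply/GP'; split => //.
    have [r [-> r0 rT]] := half_open_cone (Db _ TD) hx; exists r; split => // i.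
    by rewrite !inE negbK => /eqP ->; apply: rT.
  - by move=> /FP-/(_ TD)[_ h] /FP-/(_ T'D)[_ h']; apply: (Duniq (x, k%:R)).
have -> : (fun k => #|` G k|%:Z - #|` G' k|%:Z) =
    (fun k => \sum_(T | (T \in Delta) && (e \in T)) #|` F T k|%:Z).
  apply/funext => k; rewrite cG cG' (bigID (fun T : {set I} => e \in T)) /=.
  by rewrite PoszD addrK (big_morph Posz PoszD (erefl _)).
move=> k; rewrite iter_diff_sum; apply: sumr_ge0 => T /andP[TD _].
have bT := Db _ TD.
rewrite -(card_isbasis bT) cardE.
have coV u i j : j \in T -> co lifted T (u + lifted j) i = co lifted T u i + (i == j)%:R.
  by move=> jT; rewrite coD // co_gen.
have coVB u i j : j \in T -> co lifted T (u - lifted j) i = co lifted T u i - (i == j)%:R.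
  by move=> jT; rewrite coB // co_gen.
have expB u j : u = \sum_i co lifted T u i *: lifted i -> j \in T ->
  u - lifted j = \sum_i co lifted T (u - lifted j) i *: lifted i.
  move=> uE jT; under eq_bigr => i _ do rewrite coB // scalerBl.
  by rewrite sumrB -uE -co_genE.
apply: (iter_diff_card_ge0 (v := v)); first exact: enum_uniq.
  move=> l x i; rewrite mem_enum => iT /FP-/(_ TD)[Lx [xE hx]].
  apply/FP => //; split; first exact: LD.
  have -> : (x + v i, l.+1%:R : R^o) = (x, l%:R : R^o) + lifted i.
    by congr pair; rewrite -natr1.
  split=> [|j jT].
    under eq_bigr => j _ do rewrite coD // scalerDl.
    by rewrite big_split /= -xE -co_genE.
  rewrite coV //; have [->|_] := eqVneq j i; last by rewrite addr0 hx.
  rewrite /lexpos ltr_wpDl //.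
  by have := hx i iT; rewrite /lexpos => /orP[/ltW //|/andP[/eqP -> _]].
move=> l x i j; rewrite !mem_enum => iT jT ij /FP-/(_ TD)[Lx [xE hx]].
move=> /FP-/(_ TD)[_ [_ hx']].
(* Subtracting [lifted j] affects only the condition at [j]; there [lifted i] has coordinate 0, so
   [hx'] supplies it. *)
have hxj : half_open lifted q T ((x, l%:R : R^o) - lifted j).
  split=> [|m mT]; first exact: expB.
  have [->|mj] := eqVneq m j; last by rewrite coVB // (negbTE mj) subr0 hx.
  have := hx' j jT.
  have -> : (x + v i - v j, l%:R : R^o) = (x, l%:R : R^o) + lifted i - lifted j.
    by congr pair; rewrite /= addrK.
  by rewrite !coVB // coV // [j == i]eq_sym (negbTE ij) addr0.
have pE : (x, l%:R : R^o) - lifted j = (x - v j, l%:R - 1 : R^o) by [].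
(* At degree 0 the difference has degree -1, impossible in a cone, where degrees are sums of
   nonnegative coefficients. *)
case: l xE hx hx' pE hxj => [|l] xE hx hx' pE; rewrite pE => hxj /=.
  have /cone_deg[r [_ d r0 _]] := half_open_cone bT hxj.
  have : 0 <= \sum_i r i by apply: sumr_ge0.
  by rewrite -d /= sub0r oppr_ge0 ler10.
apply/FP => //; split; first exact: LB.
by move: hxj; rewrite -natr1 addrK.
Qed.

End Monotonicity.

(** * Convex hulls of finite families *)

Section ConvexHull.
Local Open Scope classical_set_scope.
Variables (R : realType) (V : lmodType R).

Lemma conv_lmodE (p : {i01 R}) (a b : convex_lmodType V) :
  conv p a b = p%:num *: (a : V) + (1 - p%:num) *: (b : V).
Proof. by []. Qed.

Lemma convex_set_sum (C : set V) (I : Type) (s : seq I) (r : I -> R) (v : I -> V) :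
  @convex_set R V C -> (forall i, 0 <= r i) -> (forall i, C (v i)) ->
  0 < \sum_(i <- s) r i ->
  C ((\sum_(i <- s) r i)^-1 *: \sum_(i <- s) r i *: v i).
Proof.
move=> cC r0 Cv; elim: s => [|i s IH]; first by rewrite big_nil ltxx.
rewrite !big_cons; set a := \sum_(j <- s) r j; set x := \sum_(j <- s) _ => ra.
have a0 : 0 <= a by apply: sumr_ge0.
(* Tail weights with sum 0 all vanish; the case is separate because the recursive average divides by
   their sum. *)
have [ae|an] := eqVneq a 0.
  have -> : x = 0.
    rewrite /x; elim: s @a @x {IH} a0 ae ra => [|j s IH] a x; first by rewrite big_nil.
    rewrite /a big_cons => a0 /eqP; rewrite paddr_eq0 ?sumr_ge0 //.
    move=> /andP[/eqP rj /eqP sj].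
    rewrite rj sj => ri; rewrite big_cons rj scale0r add0r; apply: IH => //.
      by rewrite sj.
    by move: ri; rewrite add0r sj.
  rewrite ae !addr0 scalerA mulVf ?scale1r //.
  by rewrite gt_eqF //; move: ra; rewrite ae addr0.
have ap : 0 < a by rewrite lt_neqAle eq_sym an.
have p0 : 0 <= r i / (r i + a) by rewrite divr_ge0 // ltW.
have p1 : r i / (r i + a) <= 1 by rewrite ler_pdivrMr // mul1r lerDl.
have := cC (v i) (a^-1 *: x) (Itv01 p0 p1).
rewrite !inE => /(_ (Cv i) (IH ap)).
suff -> : (r i + a)^-1 *: (r i *: v i + x) =
  conv (Itv01 p0 p1) (v i : convex_lmodType V) (a^-1 *: x : convex_lmodType V) by [].
rewrite conv_lmodE /= scalerDr !scalerA; congr (_ *: _ + _ *: _).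
  by rewrite mulrC.
by field; rewrite an gt_eqF.
Qed.

Lemma conv_hull_range (I : finType) (v : I -> V) (x : V) :
  conv_hull (range v) x <-> exists r : I -> R,
    [/\ x = \sum_i r i *: v i, \sum_i r i = 1 & forall i, 0 <= r i].
Proof.
split=> [|[r [-> r1 r0]] C [cC vC]].
  pose C : set V := [set x | exists r : I -> R,
    [/\ x = \sum_i r i *: v i, \sum_i r i = 1 & forall i, 0 <= r i]].
  apply: (_ : conv_hull _ `<=` C); apply: smallest_sub => [|_ [i _ <-]].
    move=> a b p /set_mem[r [-> r1 r0]] /set_mem[s [-> s1 s0]]; apply/mem_set.
    exists (fun i => p%:num * r i + (1 - p%:num) * s i); split.
    - rewrite conv_lmodE !scaler_sumr -big_split /=; apply: eq_bigr => i _.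
      by rewrite !scalerA -scalerDl.
    - by rewrite big_split /= -!mulr_sumr r1 s1 !mulr1 addrC subrK.
    - have p0 : 0 <= p%:num by [].
      have p1 : p%:num <= 1 by [].
      by move=> i; rewrite addr_ge0 // mulr_ge0 // subr_ge0.
  exists (fun j => (j == i)%:R); split => //.
    rewrite (bigD1 i) //= eqxx scale1r big1 ?addr0 // => j /negbTE ->.
    by rewrite scale0r.
  by rewrite (bigD1 i) //= eqxx big1 ?addr0 // => j /negbTE ->.
have := @convex_set_sum C _ (index_enum I) r v cC r0.
by rewrite r1 invr1 scale1r; apply => // i; apply: vC; exists i.
Qed.

End ConvexHull.

(** * Extended root polytopes *)

Section RootPolytope.
Variable R : realType.
Implicit Type D : digraph.

(** [None] stands for the point 0 of the generating set. *)
Definition gen D : option (edge D) -> {ffun vertex D -> R^o} :=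
  oapp (@edge_vector R D) 0.
Arguments gen : clear implicits.

Lemma big_option (K : finType) (W : zmodType) (F : option K -> W) :
  \sum_i F i = F None + \sum_k F (Some k).
Proof.
rewrite (bigD1 None) //=; congr (_ + _); rewrite (reindex_omap Some id) => [|[k|] //].
by apply: eq_bigl => k; rewrite eqxx.
Qed.

(** The coefficient of [None], whose vector is 0, is a slack variable turning the degree equation
    into an inequality. *)
Lemma cone_genP D (J : {set option (edge D)}) x (k : R^o) : None \in J ->
  cone (lifted (gen D)) J (x, k) <-> exists r : edge D -> R,
    [/\ x = \sum_f r f *: edge_vector R f, \sum_f r f <= k, forall f, 0 <= r f
      & forall f, Some f \notin J -> r f = 0].
Proof.
move=> NJ; rewrite cone_deg; split=> [[r [-> -> r0 rJ]]|[r [-> rk r0 rJ]]].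
  exists (fun f => r (Some f)); split => [||f|f /rJ] //.
    by rewrite big_option /= scaler0 add0r.
  by rewrite big_option lerDr.
exists (oapp r (k - \sum_f r f)); split.
- by rewrite big_option /= scaler0 add0r.
- by rewrite big_option /= subrK.
- by case=> [f|] /=; rewrite ?subr_ge0.
- by case=> [f /rJ|] //; rewrite NJ.
Qed.

Lemma extended_root_polytopeE D :
  @extended_root_polytope R D = conv_hull (range (gen D)).
Proof.
congr conv_hull; apply/seteqP; split => [x [->|[f _ <-]]|_ [[f|] _ <-]].
- by exists None.
- by exists (Some f).
- by right; exists f.
- by left.
Qed.

Lemma dilate_cone D k x : dilate k (@extended_root_polytope R D) x <->
  cone (lifted (gen D)) [set: _] (x, k%:R).
Proof.
rewrite extended_root_polytopeE cone_deg; split.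
  move=> [z /conv_hull_range[r [-> r1 r0]] <-].
  exists (fun i => k%:R * r i); split => [||i|i].
  - by rewrite scaler_sumr; apply: eq_bigr => i _; rewrite scalerA.
  - by rewrite -mulr_sumr r1 mulr1.
  - by rewrite mulr_ge0.
  - by rewrite inE.
(* Degree 0 forces all coefficients to vanish; the point of the polytope to be scaled by 0 is then
   chosen to be 0. *)
move=> [r [-> rk r0 _]]; have [k0|k0] := eqVneq (k%:R : R) 0.
  exists 0; last first.
    rewrite scaler0 big1 // => i _; suff -> : r i = 0 by rewrite scale0r.
    move/eqP: (esym rk); rewrite k0 psumr_eq0 //.
    by move=> /allP/(_ i); rewrite mem_index_enum => /(_ isT)/eqP.
  apply/conv_hull_range; exists (fun i => (i == None)%:R); split => //.
    rewrite (bigD1 None) //= scaler0 add0r big1 // => i /negbTE ->.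
    by rewrite scale0r.
  by rewrite (bigD1 None) //= big1 ?addr0 // => i /negbTE ->.
exists (\sum_i (k%:R^-1 * r i) *: gen D i).
  apply/conv_hull_range; exists (fun i => k%:R^-1 * r i); split => //.
    by rewrite -mulr_sumr -rk mulVf.
  by move=> i; rewrite mulr_ge0 // invr_ge0 ler0n.
rewrite scaler_sumr; apply: eq_bigr => i _.
by rewrite scalerA mulrA divff // mul1r.
Qed.

Definition points D k : {fset {ffun vertex D -> R^o}} :=
  fset_set (dilate k (@extended_root_polytope R D) `&` @lattice R (vertex D))%classic.

Lemma pointsP D k x : (x \in points D k) <->
  @lattice R _ x /\ cone (lifted (gen D)) [set: _] (x, k%:R).
Proof.
rewrite in_fset_set; last exact: finite_lattice_points.
rewrite inE -dilate_cone; split=> [[]|[]] //.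
Qed.

Lemma pointsE D k x : (x \in points D k) <->
  @lattice R _ x /\ exists r : edge D -> R,
    [/\ x = \sum_f r f *: edge_vector R f, \sum_f r f <= k%:R & forall f, 0 <= r f].
Proof.
rewrite pointsP cone_genP ?inE //; split=> -[Lx [r]]; last first.
  by move=> [xE rk r0]; split => //; exists r; split => // f; rewrite inE.
by move=> [xE rk r0 _]; split => //; exists r.
Qed.

Lemma lattice_edge_vector D (f : edge D) : @lattice R _ (edge_vector R f).
Proof. by move=> u; rewrite ffunE rpredB ?rpred_nat. Qed.

Lemma latticeD (V : finType) (x z : {ffun V -> R^o}) :
  @lattice R V x -> @lattice R V z -> @lattice R V (x + z).
Proof. by move=> Lx Lz u; rewrite ffunE rpredD ?Lx ?Lz. Qed.

Lemma latticeB (V : finType) (x z : {ffun V -> R^o}) :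
  @lattice R V x -> @lattice R V z -> @lattice R V (x - z).
Proof. by move=> Lx Lz u; rewrite !ffunE rpredB ?Lx ?Lz. Qed.

Lemma hstar_coefE D i :
  hstar_coef (@extended_root_polytope R D) i =
  iter (polytope_dim (@extended_root_polytope R D)).+1 diff
    (fun k => #|` points D k|%:Z) i.
Proof. by rewrite -coef_1subX_exp. Qed.

Definition edge_span D := <<codom (@edge_vector R D)>>%VS.

Lemma exists_edge_basis D : exists T, isbasis (@edge_vector R D) T.
Proof.
have [f|T bT _] := exists_isbasis (y := @edge_vector R D) (J := [set: edge D]).
  exists (fun g => (g == f)%:R) => [|g]; last by rewrite inE.
  rewrite (bigD1 f) //= eqxx scale1r big1 ?addr0 // => g /negbTE ->.
  by rewrite scale0r.
by exists T.
Qed.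

(** The polytope contains 0, so its affine hull is the linear span of the edge vectors. *)
Lemma polytope_dimE D :
  polytope_dim (@extended_root_polytope R D) = \dim (edge_span D).
Proof.
have memQ x : extended_root_polytope x -> x \in edge_span D.
  rewrite extended_root_polytopeE => /conv_hull_range[r [-> _ _]].
  rewrite big_option scaler0 add0r; apply: memv_suml => f _.
  exact/memvZ/memv_span/codom_f.
have Qgen i : extended_root_polytope (gen D i).
  by rewrite extended_root_polytopeE => C [_]; apply; exists i.
apply/eqP; rewrite eqn_leq; apply/andP; split.
  apply/bigmax_leqP => k /asboolP[x0 [t [Qx0 Qt /eqP ft]]].
  rewrite -{1}(size_tuple t) -ft; apply/dimvS/span_subvP => u /tnthP[i ->].
  by rewrite -[tnth t i](addKr x0) memvD ?memvN ?memQ // addrC.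
have [T bT] := exists_edge_basis D.
have /andP[_ fT] := isbasis_basis_of bT.
have cT : (#|T| < (\dim {: {ffun vertex D -> R^o}}).+1)%N.
  by rewrite ltnS (card_isbasis bT) dimvS ?subvf.
rewrite -(card_isbasis bT) -[#|T|]/(nat_of_ord (Ordinal cT)).
apply: (@leq_bigmax_cond _ _ (fun k : 'I__ => nat_of_ord k)).
apply/asboolP; exists 0, [tuple edge_vector R (enum_val m) | m < #|T|]; split => //.
  exact: (Qgen None).
by move=> i; rewrite add0r tnth_mktuple; apply: (Qgen (Some _)).
Qed.

(** A basis of the edge vectors becomes one of the lifted family by adding [None], the vector
    [(0, 1)]; its coordinate is the degree minus the sum of the others. *)
Lemma dim_lifted D : \dim <<codom (lifted (gen D))>> = (\dim (edge_span D)).+1.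
Proof.
have [T bT] := exists_edge_basis D.
pose S := None |: [set Some f | f in T].
suff bS : isbasis (lifted (gen D)) S.
  rewrite -(card_isbasis bS) -(card_isbasis bT) cardsU1 card_imset; last exact: Some_inj.
  by rewrite (_ : None \notin _) //; apply/imsetP => -[].
have SN : None \in S by rewrite !inE.
have SS f : (Some f \in S) = (f \in T).
  by rewrite !inE /= mem_imset //; exact: Some_inj.
pose g (u : {ffun vertex D -> R^o} * R^o) (i : option (edge D)) : R :=
  oapp (co (@edge_vector R D) T u.1)
    (u.2 - \sum_f co (@edge_vector R D) T u.1 f) i.
apply/asboolP; exists g; split.
- move=> [f|] k [u a] [w b]; rewrite /g /= ?coDZ //.
  under eq_bigr => f _ do rewrite coDZ //.
  by rewrite big_split /= -mulr_sumr mulrBr opprD addrACA.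
- by move=> [u a] [f|]; rewrite ?SN // SS => fT; rewrite /g /= co_out.
- move=> [f|] [h|]; rewrite ?SS => hT; rewrite /g /= ?co0 // ?co_gen //.
    rewrite (eq_bigr (fun f => (f == h)%:R)); last by move=> f _; rewrite co_gen.
    by rewrite (bigD1 h) //= eqxx big1 ?addr0 ?subrr // => f /negbTE ->.
  by rewrite big1 ?subr0 // => f _; rewrite co0.
- move=> j; rewrite sum_lifted !big_option /g /= scaler0 add0r subrK.
  congr pair; case: j => [f|] /=; first exact: (co_genE bT).
  by rewrite big1 // => f _; rewrite co0 // scale0r.
Qed.

End RootPolytope.

(** * Deleting an edge *)

Section DeleteEdge.
Variables (R : realType) (D : digraph) (e : edge D).
Let D' := delete_edge e.
Let ev := @edge_vector R D.

Lemma sum_delete_edge (W : zmodType) (F : edge D -> W) :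
  \sum_(g : edge D') F (val g) = \sum_(f | f != e) F f.
Proof.
rewrite [RHS](reindex_omap (val : edge D' -> edge D) insub) => [|f fe]; last first.
  by rewrite insubT.
by apply: eq_bigl => -[f fe] /=; rewrite fe insubT eqxx.
Qed.

Lemma points_delete_edge k x : (x \in points R D' k) <->
  @lattice R _ x /\ exists r : edge D -> R,
    [/\ x = \sum_f r f *: ev f, \sum_f r f <= k%:R, forall f, 0 <= r f & r e = 0].
Proof.
rewrite pointsE; split=> -[Lx [r]].
  move=> [xE rk r0]; split => //.
  pose s f : R := if insub f is Some g then r (g : edge D') else 0.
  have sval (g : edge D') : s (val g) = r g by rewrite /s valK.
  have se : s e = 0 by rewrite /s insubF // eqxx.
  exists s; split => // [||f].
  - rewrite (bigD1 e) //= se scale0r add0r.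
    rewrite -(sum_delete_edge (fun f => s f *: ev f)) xE.
    by apply: eq_bigr => g _; rewrite sval.
  - rewrite (bigD1 e) //= se add0r -(sum_delete_edge s).
    by rewrite (eq_bigr r) // => g _; rewrite sval.
  - by rewrite /s; case: insubP.
move=> [xE rk r0 re]; split => //; exists (fun g => r (val g)); split => //.
  rewrite xE (bigD1 e) //= re scale0r add0r.
  by rewrite -(sum_delete_edge (fun f => r f *: ev f)).
by move: rk; rewrite (bigD1 e) //= re add0r -(sum_delete_edge r).
Qed.

Lemma edge_span_delete : edge_span R D = (<[ev e]> + edge_span R D')%VS.
Proof.
apply/eqP; rewrite eqEsubv; apply/andP; split.
  apply/span_subvP => _ /codomP[f ->]; have [->|fe] := eqVneq f e.
    by apply: (subvP (addvSl _ _)); rewrite memv_line.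
  apply: (subvP (addvSr _ _)); apply: memv_span.
  exact: (codom_f (@edge_vector R D') (Sub f fe)).
rewrite subv_add; apply/andP; split; first exact/memv_span/codom_f.
by apply/span_subvP => _ /codomP[f ->]; apply/memv_span/(codom_f ev).
Qed.

Lemma dim_edge_span_delete_leq : (\dim (edge_span R D') <= \dim (edge_span R D))%N.
Proof. by rewrite edge_span_delete dimvS // addvSr. Qed.

Lemma adjacent_sym (E : digraph) : symmetric (@adjacent E).
Proof. by move=> u w; apply: eq_existsb => f; rewrite orbC. Qed.

(** Telescoping along a path, with sign -1 for edges traversed backwards. *)
Lemma connect_edge_comb (E : digraph) u w : connect (@adjacent E) u w ->
  exists b : edge E -> R,
    [ffun x => (x == w)%:R - (x == u)%:R] = \sum_f b f *: edge_vector R f.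
Proof.
move=> /connectP[p]; elim: p u => [|z p IH] u /=.
  move=> _ ->; exists (fun=> 0); rewrite big1 => [|f _]; last by rewrite scale0r.
  by apply/ffunP => x; rewrite !ffunE subrr.
move=> /andP[/existsP[f uz] pz] wE; have [b bE] := IH _ pz wE.
pose s : R := if (tail f == u) && (head f == z) then 1 else -1.
exists (fun g => b g + s * (g == f)%:R).
rewrite (eq_bigr (fun g => b g *: edge_vector R g
  + s *: ((g == f)%:R *: edge_vector R g))); last first.
  by move=> g _; rewrite scalerDl scalerA.
rewrite big_split /= -bE -scaler_sumr (bigD1 f) //= eqxx scale1r big1 ?addr0.
  apply/ffunP => x; rewrite !ffunE /s; move: uz.
  case: ifP => [/andP[/eqP-> /eqP->] _|_ /=].
    by rewrite scale1r addrA subrK.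
  by move=> /andP[/eqP-> /eqP->]; rewrite scaleN1r opprB addrA subrK.
by move=> g /negbTE ->; rewrite scale0r.
Qed.

Lemma connected_comb : connect (@adjacent D') (tail e) (head e) ->
  exists b : edge D -> R, ev e = \sum_(f | f != e) b f *: ev f.
Proof.
move=> /connect_edge_comb[b bE].
pose s f : R := if insub f is Some g then b (g : edge D') else 0.
exists s; rewrite -(sum_delete_edge (fun f => s f *: ev f)).
by rewrite /ev /edge_vector bE; apply: eq_bigr => g _; rewrite /s valK.
Qed.

(** Here [e] is not a bridge, so the dimensions agree and the two coefficients differ by one
    iterated difference of point counts, to which [iter_diff_cone_ge0] applies. *)
Lemma hstar_coef_delete_connected i : connect (@adjacent D') (tail e) (head e) ->
  hstar_coef (@extended_root_polytope R D') i <=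
  hstar_coef (@extended_root_polytope R D) i.
Proof.
move=> /connected_comb[b eE].
have dimE : \dim (edge_span R D') = \dim (edge_span R D).
  apply/eqP; rewrite eqn_leq dim_edge_span_delete_leq edge_span_delete dimvS //.
  rewrite subv_add subvv andbT -memvE eE; apply: memv_suml => f fe.
  exact/memvZ/memv_span/(codom_f (@edge_vector R D') (Sub f fe)).
rewrite !hstar_coefE !polytope_dimE dimE -subr_ge0.
rewrite -(congr1 (fun f => f i) (iter_diffB _ _ _)) -dim_lifted.
pose b' f : R := if f == e then 0 else b f.
have b'E (W : zmodType) (F : edge D -> R -> W) : F e 0 = 0 ->
    \sum_f F f (b' f) = \sum_(f | f != e) F f (b f).
  move=> Fe; rewrite (bigD1 e) //= /b' eqxx Fe add0r.
  by apply: eq_bigr => f /negbTE ->.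
(* The weight at [None] makes the total 1, so that degrees match as well as vectors. *)
pose c := oapp b' (1 - \sum_f b' f).
have cE : lifted (@gen R D) (Some e) =
    \sum_(j | j != Some e) c j *: lifted (@gen R D) j.
  have := sum_lifted (@gen R D) c; rewrite (bigD1 (Some e)) //= {1}/b' eqxx.
  rewrite scale0r add0r => ->; rewrite !big_option /= scaler0 add0r subrK.
  congr pair; rewrite (b'E _ (fun f a => a *: ev f)) ?scale0r //.
refine (@iter_diff_cone_ge0 R _ _ _ (@lattice R (vertex D)) (Some e)
  (points R D) (points R D') _ _ _ _ c cE i).
- move=> x [f|] Lx /=; last by rewrite addr0.
  exact/latticeD/lattice_edge_vector.
- move=> x [f|] Lx /=; last by rewrite subr0.
  exact/latticeB/lattice_edge_vector.
- exact: pointsP.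
- move=> k x; rewrite points_delete_edge cone_genP ?inE //.
  split=> -[Lx [r [xE rk r0 re]]]; split => //; exists r; split => //.
    by move=> f; rewrite !inE negbK => /eqP[->].
  by apply: re; rewrite !inE eqxx.
Qed.

Definition component_sum (x : {ffun vertex D -> R^o}) : R :=
  \sum_(u | connect (@adjacent D') (head e) u) (x u : R).

(** * Deleting a bridge *)

Section Bridge.
Hypothesis bridge : ~~ connect (@adjacent D') (tail e) (head e).

(** An edge other than [e] has both ends on the same side, so its contributions cancel; [e] enters
    the side that is summed. *)
Lemma component_sum_edge f : component_sum (ev f) = (f == e)%:R.
Proof.
have indic z : \sum_(u | connect (@adjacent D') (head e) u) (u == z)%:R
    = (connect (@adjacent D') (head e) z)%:R :> R.
  case: (boolP (connect _ _ z)) => cz.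
    by rewrite (bigD1 z) //= eqxx big1 ?addr0 // => u /andP[_ /negbTE ->].
  by rewrite big1 // => u cu; case: eqVneq cu => // ->; rewrite (negbTE cz).
have csym := sym_connect_sym (@adjacent_sym D').
rewrite /component_sum; under eq_bigr => u _ do rewrite ffunE.
rewrite sumrB !indic; have [->|fe] := eqVneq f e.
  by rewrite connect0 csym (negbTE bridge) subr0.
have tf : connect (@adjacent D') (tail f) (head f).
  apply/connect1/existsP.
  by exists (Sub f fe : edge D') => /=; rewrite !eqxx.
by rewrite (same_connect_r csym tf) subrr.
Qed.

Lemma component_sum_lin (K : finType) (a : K -> R) (x : K -> {ffun vertex D -> R^o}) :
  component_sum (\sum_k a k *: x k) = \sum_k a k * component_sum (x k).
Proof.
rewrite /component_sum; under eq_bigr => u _ do rewrite sum_ffunE.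
rewrite exchange_big /=; apply: eq_bigr => k _.
by rewrite mulr_sumr; apply: eq_bigr => u _; rewrite ffunE.
Qed.

Lemma component_sum_comb (r : edge D -> R) :
  component_sum (\sum_f r f *: ev f) = r e.
Proof.
rewrite component_sum_lin (bigD1 e) //= component_sum_edge eqxx mulr1.
by rewrite big1 ?addr0 // => f fe; rewrite component_sum_edge (negbTE fe) mulr0.
Qed.

(** Translation by [ev e] embeds the points of degree [k - 1] into those of degree [k]; it misses
    exactly those with [e]-coefficient 0, the points of [D']. *)
Lemma card_points_bridge :
  diff (fun k => #|` points R D k|%:Z) = (fun k => #|` points R D' k|%:Z).
Proof.
apply/funext => k.
pose tr := [fset (x + ev e)%R | x in prev_fset (points R D) k]%fset.
have trE x : (x \in tr) = (x - ev e \in prev_fset (points R D) k).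
  apply/imfsetP/idP => [[z zF ->]|xF]; first by rewrite addrK.
  by exists (x - ev e) => //=; rewrite subrK.
have ctr : #|` tr|%:Z = if k is k'.+1 then #|` points R D k'|%:Z else 0.
  by rewrite card_imfset /=; [case: (k) => //=; rewrite cardfs0 | exact: addIr].
have addE l x : x \in points R D l -> x + ev e \in points R D l.+1.
  move=> /pointsE[Lx [r [xE rl r0]]]; apply/pointsE; split.
    exact/latticeD/lattice_edge_vector.
  exists (fun f => r f + (f == e)%:R); split => [||f].
  - under eq_bigr => f _ do rewrite scalerDl.
    rewrite big_split /= -xE (bigD1 (P := predT) e) //= eqxx scale1r big1 ?addr0 //.
    by move=> f /negbTE ->; rewrite scale0r.
  - rewrite big_split /= -natr1 lerD // (bigD1 e) //= eqxx big1 ?addr0 //.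
    by move=> f /negbTE ->.
  - by rewrite addr_ge0.
have trD : (tr `<=` points R D k)%fset.
  apply/fsubsetP => x; rewrite trE; case: (k) => [|l] /=; first by rewrite inE.
  by move=> /addE; rewrite subrK.
rewrite /diff -ctr subzn ?fsubset_leq_card // -cardfsDS //; congr (Posz #|` _|).
apply/fsetP => x; rewrite inE trE; apply/andP/idP => [[xn /pointsE]|]; last first.
  move=> /points_delete_edge[Lx [r [xE rk r0 re]]]; split; last first.
    by apply/pointsE; split => //; exists r.
  case: (k) => [|l] //=.
  (* Any representation of [x - ev e] has [e]-coefficient -1, since [component_sum] determines
     it. *)
  apply/negP => /pointsE[_ [s [sE _ s0]]].
  have := s0 e; have := component_sum_comb s; rewrite -sE.
  have -> : x - ev e = \sum_f (r f - (f == e)%:R) *: ev f.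
    under eq_bigr => f _ do rewrite scalerBl.
    rewrite sumrB -xE [X in _ = _ - X](bigD1 e) //= eqxx scale1r big1 ?addr0 //.
    by move=> f /negbTE ->; rewrite scale0r.
  by rewrite component_sum_comb re eqxx sub0r => <-; rewrite oppr_ge0 ler10.
move=> [Lx [r [xE rk r0]]]; apply/points_delete_edge; split => //; exists r; split => //.
(* The coefficient is a sum of integral coordinates of [x]; if nonzero it is at least 1, so one copy
   of [ev e] can be removed. *)
have rint : r e \is a Num.int.
  by rewrite -component_sum_comb -xE; apply: rpred_sum => u _; apply: Lx.
apply: contraNeq xn => re.
have re1 : 1 <= r e.
  have /natrP[m mE] : r e \is a Num.nat by rewrite natrEint rint r0.
  by move: re; rewrite mE pnatr_eq0 ler1n lt0n.
case: (k) rk => [|l] rk /=.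
  have : r e <= 0 by apply: le_trans rk; rewrite (bigD1 e) //= lerDl sumr_ge0.
  by lra.
apply/pointsE; split; first exact/latticeB/lattice_edge_vector.
exists (fun f => r f - (f == e)%:R); split.
- under eq_bigr => f _ do rewrite scalerBl.
  rewrite sumrB -xE [X in _ = _ - X](bigD1 e) //= eqxx scale1r big1 ?addr0 //.
  by move=> f /negbTE ->; rewrite scale0r.
- have sum1 : \sum_f (f == e)%:R = 1 :> R.
    by rewrite (bigD1 e) //= eqxx big1 ?addr0 // => f /negbTE ->.
  by rewrite sumrB sum1 lerBlDr natr1.
- by move=> f; have [->|_] := eqVneq f e; rewrite ?subr_ge0 ?subr0.
Qed.

Lemma dim_edge_span_bridge : \dim (edge_span R D) = (\dim (edge_span R D')).+1.
Proof.
have ev0 : ev e != 0.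
  apply/eqP => ev0; have := component_sum_edge e; rewrite ev0 /component_sum eqxx.
  rewrite big1 => [/eqP|u _]; last by rewrite ffunE.
  by rewrite eq_sym oner_eq0.
rewrite edge_span_delete dimv_disjoint_sum ?dim_vline ?ev0 //.
(* [component_sum] vanishes on the span for [D'] and sends [a *: ev e] to [a], so the intersection
   is zero. *)
apply/eqP; rewrite -subv0; apply/subvP => x; rewrite memv_cap => /andP[/vlineP[a ->]].
have [T bT] := exists_edge_basis R D'.
move=> /(coord_basis (isbasis_basis_of bT))/(congr1 component_sum).
rewrite component_sum_lin [RHS]big1 => [|m _]; last first.
  rewrite -tnth_nth tnth_mktuple (component_sum_edge (val (enum_val m))).
  by rewrite (negbTE (valP (enum_val m))) mulr0.
have := component_sum_lin (fun _ : 'I_1 => a) (fun=> ev e).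
rewrite !big_ord_recl !big_ord0 !addr0 => ->.
rewrite component_sum_edge eqxx mulr1 => ->.
by rewrite scale0r mem0v.
Qed.

(** The dimension of [D] is one larger; the additional difference is the one that turns its counts
    into those of [D']. *)
Lemma hstar_coef_delete_bridge i :
  hstar_coef (@extended_root_polytope R D) i =
  hstar_coef (@extended_root_polytope R D') i.
Proof.
by rewrite !hstar_coefE !polytope_dimE dim_edge_span_bridge iterSr card_points_bridge.
Qed.

End Bridge.

Lemma hstar_coef_delete_le i :
  hstar_coef (@extended_root_polytope R D') i <=
  hstar_coef (@extended_root_polytope R D) i.
Proof.
case: (boolP (connect (@adjacent D') (tail e) (head e))) => [|bridge].
  exact: hstar_coef_delete_connected.
by rewrite (hstar_coef_delete_bridge bridge).
Qed.

End DeleteEdge.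

(** Deleting edges one by one never raises a coefficient, and ends with an edgeless digraph, whose
    polytope is the point 0 with h*-polynomial 1. *)
Lemma hstar_coef_ge0 (R : realType) (D : digraph) i :
  0 <= hstar_coef (@extended_root_polytope R D) i.
Proof.
have [n] := ubnP #|edge D|; elim: n D => // n IH D cD.
have [c0|/card_gt0P[e eD]] := posnP #|edge D|; last first.
  apply: le_trans (hstar_coef_delete_le R e i); apply: IH.
  rewrite (_ : #|edge (delete_edge e)| = #|edge D|.-1).
    by rewrite -ltnS prednK //; apply/card_gt0P; exists e.
  by rewrite card_sig; exact: cardC1.
have noE (f : edge D) : False by have := card0_eq c0 f; rewrite inE.
have cP k : #|` points R D k| = 1%N.
  rewrite (_ : points R D k = [fset 0]%fset) ?cardfs1 //.
  apply/fsetP => x; rewrite inE; apply/idP/eqP => [/pointsE[_ [r [-> _ _]]]|->].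
    by rewrite big1 // => f _; case: (noE f).
  apply/pointsE; split; first by move=> u; rewrite ffunE rpred0.
  by exists (fun=> 0); split => //; rewrite big1 // => f; case: (noE f).
have d0 : \dim (edge_span R D) = 0%N.
  apply/eqP; rewrite dimv_eq0 -subv0; apply/span_subvP => u /codomP[f _].
  by case: (noE f).
rewrite hstar_coefE polytope_dimE d0 /= /diff cP.
by case: (i) => [|j] //; rewrite cP.
Qed.

Theorem theorem1p1 (R : realType) (D : digraph) (e : edge D) :
  weakly_connected D ->
  forall i : nat,
    (hstar_digraph R (delete_edge e))`_i <= (hstar_digraph R D)`_i.
Proof.
move=> _ i; rewrite !coef_poly.
have := dim_edge_span_delete_leq R e; rewrite -!polytope_dimE => dle.
(* Each polynomial is cut off at its own dimension: above that of [D - e] the left side is 0, and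
   nonnegativity for [D] suffices. *)
case: ltnP => [id|_]; last by case: ltnP => // _; apply: hstar_coef_ge0.
by rewrite (leq_trans id) ?ltnS // hstar_coef_delete_le.
Qed.
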